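(* Let $n\in\mathbb N$ with $n\ge2$. The logic $\mathcal L(\mathbb V(\mathbf C_n^{dp})\vee\mathbb V(\mathbf D_2))$ is defined, as an axiomatic extension of the logic $\mathcal{JIDL}_1$, by $$\alpha_1\vee\alpha_2\vee\cdots\vee\alpha_n\vee(\alpha_1\to\alpha_2)\vee(\alpha_2\to\alpha_3)\vee\cdots\vee(\alpha_{n-1}\to\alpha_n).$$
   Context: Language: $\langle\vee,\wedge,\to,\sim,\bot,\top\rangle$ of arities $2,2,2,1,0,0$. $\alpha\to_H\beta$ abbreviates $\alpha\to(\alpha\wedge\beta)$. The logic $\mathcal{DHMSH}$ is the Hilbert-style logic with axiom schemes: (A1) $\alpha\to_H(\alpha\vee\beta)$; (A2) $\beta\to_H(\alpha\vee\beta)$; (A3) $(\alpha\to_H\gamma)\to_H[(\beta\to_H\gamma)\to_H((\alpha\vee\beta)\to_H\gamma)]$; (A4) $(\alpha\wedge\beta)\to_H\alpha$; (A5) $(\gamma\to_H\alpha)\to_H[(\gamma\to_H\beta)\to_H(\gamma\to_H(\alpha\wedge\beta))]$; (A6) $\top$; (A7) $\bot\to_H\alpha$; (A8) $((\alpha\wedge\beta)\to_H\gamma)\to_H(\alpha\to_H(\beta\to_H\gamma))$; (A9) $(\alpha\to_H(\beta\to_H\gamma))\to_H((\alpha\wedge\beta)\to_H\gamma)$; (A10) $(\alpha\to_H\beta)\to_H((\beta\to_H\alpha)\to_H((\alpha\to\gamma)\to_H(\beta\to\gamma)))$; (A11) $(\alpha\to_H\beta)\to_H((\beta\to_H\alpha)\to_H((\gamma\to\beta)\to_H(\gamma\to\alpha)))$;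 (A12) $\top\to_H{\sim}\bot$; (A13) ${\sim}\top\to_H\bot$; (A14) ${\sim}(\alpha\wedge\beta)\to_H({\sim}\alpha\vee{\sim}\beta)$; and rules (SMP): from $\phi$ and $\phi\to_H\gamma$ deduce $\gamma$; (SCP): from $\phi\to_H\gamma$ deduce ${\sim}\gamma\to_H{\sim}\phi$ (both applicable to any formulas derived from the premises). An axiomatic extension is obtained by adjoining new axiom schemes and keeping the same rules. A semi-Heyting algebra is an algebra $\langle L,\vee,\wedge,\to,0,1\rangle$ such that $\langle L,\vee,\wedge,0,1\rangle$ is a lattice with $0$ and $1$, and $x\wedge(x\to y)\approx x\wedge y$, $x\wedge(y\to z)\approx x\wedge[(x\wedge y)\to(x\wedge z)]$, $x\to x\approx1$. $\mathbb{DHMSH}$ is the variety of algebras $\langle A,\vee,\wedge,\to,{}',0,1\rangle$ such that $\langle A,\vee,\wedge,\to,0,1\rangle$ is a semi-Heyting algebra and $0'\approx1$, $1'\approx0$, $(x\wedge y)'\approx x'\vee y'$. Formulas are interpreted with $\sim,\bot,\top$ as ${}',0,1$. Put $x^*:=x\to0$. $\mathbb{DQDSH}$ is the subvariety of $\mathbb{DHMSH}$ defined by $(x\vee y)''\approx x''\vee y''$, $x'''\approx x'$, $x''\le x$. $\mathbb{JIDL}_1$ is the subvariety of $\mathbb{DQDSH}$ defined by: (JID) $x'\vee(y\to z)\approx(x'\vee y)\to(x'\vee z)$; level 1: $x\wedge x'^*\approx x\wedge x'^*\wedge x'^*{}'^*$ (unary operations composed from left to right; for the varieties considered here the paper takes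 this to be equivalent to $x\wedge x'^*\approx(x\wedge x'^* )'^*$); and (L) $(x\to y)\vee(y\to x)\approx1$. The logic corresponding to a subvariety $\mathbb V$ of $\mathbb{DHMSH}$, denoted $\mathcal L(\mathbb V)$, is the unique axiomatic extension $\mathcal E$ of $\mathcal{DHMSH}$ such that $\mathbb V=\{\mathbf A\in\mathbb{DHMSH}:\mathbf A\models\delta\approx1\text{ for every theorem }\delta\text{ of }\mathcal E\}$. $\mathcal{JIDL}_1$ is the logic corresponding to $\mathbb{JIDL}_1$. $\mathbf C_n^{dp}$ is the $n$-element dually pseudocomplemented Heyting chain: an $n$-element chain with its Heyting implication ($x\to y=1$ if $x\le y$, else $y$), $1'=0$, and $x'=1$ for $x\ne1$. $\mathbf D_2$ is the four-element Boolean lattice $\{0,a,b,1\}$ with Boolean implication $x\to y=x^c\vee y$ ($x^c$ the Boolean complement) and $0'=1$, $1'=0$, $a'=a$, $b'=b$. $\mathbb V(\cdot)$ denotes the generated variety, and $\vee$ between varieties denotes join in the lattice of subvarieties. *)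

(* Defs.v *)
From mathcomp Require Import all_boot.

Set Implicit Arguments.
Unset Strict Implicit.
Unset Printing Implicit Defensive.

Record algebra : Type := Algebra {
  carrier :> Type;
  join : carrier -> carrier -> carrier;
  meet : carrier -> carrier -> carrier;
  imp  : carrier -> carrier -> carrier;
  neg  : carrier -> carrier;
  bot  : carrier;
  top  : carrier }.

Arguments bot {_}.
Arguments top {_}.

Local Notation "x ⊔ y" := (join x y) (at level 50, left associativity).
Local Notation "x ⊓ y" := (meet x y) (at level 40, left associativity).
Local Notation "x ⇒ y" := (imp x y) (at level 55, right associativity).
Local Notation "x ′" := (neg x) (at level 1, left associativity, format "x ′").

Definition le (A : algebra) (x y : A) : Prop := x ⊓ y = x.

Definition pc (A : algebra) (x : A) : A := x ⇒ bot.
Local Notation "x ^*" := (pc x).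

Definition is_bounded_lattice (A : algebra) : Prop :=
  [/\ (forall x y : A, x ⊔ y = y ⊔ x) /\ (forall x y : A, x ⊓ y = y ⊓ x),
      (forall x y z : A, x ⊔ (y ⊔ z) = x ⊔ y ⊔ z) /\
      (forall x y z : A, x ⊓ (y ⊓ z) = x ⊓ y ⊓ z),
      (forall x y : A, x ⊔ (x ⊓ y) = x) /\ (forall x y : A, x ⊓ (x ⊔ y) = x) &
      (forall x : A, x ⊔ bot = x) /\ (forall x : A, x ⊓ top = x)].

Definition is_semi_heyting (A : algebra) : Prop :=
  [/\ is_bounded_lattice A,
      forall x y : A, x ⊓ (x ⇒ y) = x ⊓ y,
      forall x y z : A, x ⊓ (y ⇒ z) = x ⊓ ((x ⊓ y) ⇒ (x ⊓ z)) &
      forall x : A, x ⇒ x = top].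

Definition algebra_class := algebra -> Prop.

Definition DHMSH : algebra_class := fun A =>
  [/\ is_semi_heyting A,
      (bot : A)′ = top,
      (top : A)′ = bot &
      forall x y : A, (x ⊓ y)′ = x′ ⊔ y′].

Definition DQDSH : algebra_class := fun A =>
  [/\ DHMSH A,
      forall x y : A, (x ⊔ y)′′ = x′′ ⊔ y′′,
      forall x : A, x′′′ = x′ &
      forall x : A, le x′′ x].

Definition JIDL1 : algebra_class := fun A =>
  [/\ DQDSH A,
      forall x y z : A, x′ ⊔ (y ⇒ z) = (x′ ⊔ y) ⇒ (x′ ⊔ z),
      forall x : A, x ⊓ x′^* = x ⊓ x′^* ⊓ x′^*′^* &
      forall x y : A, (x ⇒ y) ⊔ (y ⇒ x) = top].

Definition is_hom (A B : algebra) (f : A -> B) : Prop :=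
  [/\ (forall x y, f (x ⊔ y) = f x ⊔ f y) /\ (forall x y, f (x ⊓ y) = f x ⊓ f y),
      forall x y, f (x ⇒ y) = f x ⇒ f y,
      forall x, f x′ = (f x)′ &
      f bot = bot /\ f top = top].

Definition product (I : Type) (A : I -> algebra) : algebra := {|
  carrier := forall i, A i;
  join := fun x y i => x i ⊔ y i;
  meet := fun x y i => x i ⊓ y i;
  imp := fun x y i => x i ⇒ y i;
  neg := fun x i => (x i)′;
  bot := fun i => bot;
  top := fun i => top |}.

(** Subalgebras are given by embeddings, i.e. up to isomorphism; this makes no
    difference for classes that are also closed under homomorphic images. *)
Definition is_variety (V : algebra_class) : Prop :=
  [/\ forall (A B : algebra) (f : A -> B),
        V A -> is_hom f -> (forall b, exists a, f a = b) -> V B,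
      forall (A B : algebra) (f : B -> A),
        V A -> is_hom f -> injective f -> V B &
      forall (I : Type) (A : I -> algebra),
        (forall i, V (A i)) -> V (product A)].

Definition generated_variety (K : algebra_class) : algebra_class := fun A =>
  forall V, is_variety V -> (forall B, K B -> V B) -> V A.

Definition variety_of (A : algebra) : algebra_class :=
  generated_variety (fun B => B = A).

(** The join of subvarieties of DHMSH: since DHMSH is itself a variety, the
    least variety containing [V] and [W] is also their least upper bound among
    the subvarieties of DHMSH. *)
Definition variety_join (V W : algebra_class) : algebra_class :=
  generated_variety (fun A => V A \/ W A).

(** The carrier is [{0, ..., n-1}] with its usual order for [n >= 1]; the
    spelling [n.-1.+1] provides the bounds [ord0] and [ord_max]. *)
Definition Cdp (n : nat) : algebra := {|
  carrier := 'I_n.-1.+1;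
  join := fun x y => if x <= y then y else x;
  meet := fun x y => if x <= y then x else y;
  imp := fun x y => if x <= y then ord_max else y;
  neg := fun x => if x == ord_max then ord0 else ord_max;
  bot := ord0;
  top := ord_max |}.

(** With [a = (true, false)] and [b = (false, true)], the swap in [neg] gives
    [a' = a] and [b' = b]. *)
Definition D2 : algebra := {|
  carrier := bool * bool;
  join := fun x y => (x.1 || y.1, x.2 || y.2);
  meet := fun x y => (x.1 && y.1, x.2 && y.2);
  imp := fun x y => (~~ x.1 || y.1, ~~ x.2 || y.2);
  neg := fun x => (~~ x.2, ~~ x.1);
  bot := (false, false);
  top := (true, true) |}.

Inductive form : Type :=
  | Var of nat
  | Or of form & form
  | And of form & form
  | Imp of form & form
  | Neg of form
  | Bot
  | Top.

Fixpoint subst (s : nat -> form) (a : form) : form :=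
  match a with
  | Var i => s i
  | Or a b => Or (subst s a) (subst s b)
  | And a b => And (subst s a) (subst s b)
  | Imp a b => Imp (subst s a) (subst s b)
  | Neg a => Neg (subst s a)
  | Bot => Bot
  | Top => Top
  end.

Fixpoint eval (A : algebra) (v : nat -> A) (a : form) : A :=
  match a with
  | Var i => v i
  | Or a b => eval v a ⊔ eval v b
  | And a b => eval v a ⊓ eval v b
  | Imp a b => eval v a ⇒ eval v b
  | Neg a => (eval v a)′
  | Bot => bot
  | Top => top
  end.

Definition valid (A : algebra) (a : form) : Prop :=
  forall v : nat -> A, eval v a = top.

Local Notation "a ∨ b" := (Or a b) (at level 50, left associativity).
Local Notation "a ∧ b" := (And a b) (at level 40, left associativity).
Local Notation "a ⟶ b" := (Imp a b) (at level 55, right associativity).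
Local Notation "∼ a" := (Neg a) (at level 35, right associativity).

Definition ImpH (a b : form) : form := a ⟶ (a ∧ b).
Local Notation "a ⟶H b" := (ImpH a b) (at level 55, right associativity).

Inductive dhmsh_axiom : form -> Prop :=
  | A1 a b : dhmsh_axiom (a ⟶H (a ∨ b))
  | A2 a b : dhmsh_axiom (b ⟶H (a ∨ b))
  | A3 a b c : dhmsh_axiom ((a ⟶H c) ⟶H ((b ⟶H c) ⟶H ((a ∨ b) ⟶H c)))
  | A4 a b : dhmsh_axiom ((a ∧ b) ⟶H a)
  | A5 a b c : dhmsh_axiom ((c ⟶H a) ⟶H ((c ⟶H b) ⟶H (c ⟶H (a ∧ b))))
  | A6 : dhmsh_axiom Top
  | A7 a : dhmsh_axiom (Bot ⟶H a)
  | A8 a b c : dhmsh_axiom (((a ∧ b) ⟶H c) ⟶H (a ⟶H (b ⟶H c)))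
  | A9 a b c : dhmsh_axiom ((a ⟶H (b ⟶H c)) ⟶H ((a ∧ b) ⟶H c))
  | A10 a b c :
      dhmsh_axiom ((a ⟶H b) ⟶H ((b ⟶H a) ⟶H ((a ⟶ c) ⟶H (b ⟶ c))))
  | A11 a b c :
      dhmsh_axiom ((a ⟶H b) ⟶H ((b ⟶H a) ⟶H ((c ⟶ b) ⟶H (c ⟶ a))))
  | A12 : dhmsh_axiom (Top ⟶H ∼ Bot)
  | A13 : dhmsh_axiom (∼ Top ⟶H Bot)
  | A14 a b : dhmsh_axiom (∼ (a ∧ b) ⟶H (∼ a ∨ ∼ b)).

(** An axiomatic extension of DHMSH is presented by a set [E] of formulas,
    read as axiom schemes: every substitution instance is an axiom.
    [derives E G a] is derivability of [a] from the premises [G]. *)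
Definition schemes := form -> Prop.

Inductive derives (E : schemes) (G : form -> Prop) : form -> Prop :=
  | D_premise a : G a -> derives E G a
  | D_axiom a : dhmsh_axiom a -> derives E G a
  | D_scheme a s : E a -> derives E G (subst s a)
  | D_SMP a b : derives E G a -> derives E G (a ⟶H b) -> derives E G b
  | D_SCP a b : derives E G (a ⟶H b) -> derives E G (∼ b ⟶H ∼ a).

Definition theorem (E : schemes) (a : form) : Prop :=
  derives E (fun _ => False) a.

(** Logics are consequence relations, so different presentations may define
    the same logic. *)
Definition same_logic (E F : schemes) : Prop :=
  forall G a, derives E G a <-> derives F G a.

Definition adjoin (E : schemes) (a : form) : schemes :=
  fun b => E b \/ b = a.

Definition corresponds (V : algebra_class) (E : schemes) : Prop :=
  forall A : algebra,
    V A <-> DHMSH A /\ (forall a, theorem E a -> valid A a).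

(** [E] presents L(V), the unique axiomatic extension corresponding to [V]. *)
Definition is_logic_of (V : algebra_class) (E : schemes) : Prop :=
  corresponds V E /\ (forall F, corresponds V F -> same_logic F E).

(** [α_1 ∨ ... ∨ α_n ∨ (α_1 → α_2) ∨ ... ∨ (α_{n-1} → α_n)] for [n >= 1],
    with [α_i := Var (i - 1)], the disjunction associating to the left. *)
Definition chain_form (n : nat) : form :=
  foldl Or (Var 0)
    ([seq Var i | i <- iota 1 n.-1] ++
     [seq Var i ⟶ Var i.+1 | i <- iota 0 n.-1]).

(* Main.v *)
Require Import Defs.
From mathcomp Require Import all_boot.
From mathcomp Require Import boolp classical_sets zify.

(** There are two independent ingredients.

    Logic. In every algebra of [DHMSH] the term [x →_H y = x ⇒ (x ⊓ y)] is the
    residual of the meet ([le_himp]), so [a ⟶H b] is valid exactly when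
    [a ≤ b] always holds; this makes the axioms sound. Conversely, the formulas
    modulo interderivability from a set of premises form an algebra of [DHMSH],
    the Lindenbaum algebra. Hence derivability is semantic consequence over the
    algebras that validate the theorems ([derivesP]), a class of algebras has at
    most one logic, and a class defined by equations within [DHMSH] has one
    ([equational_corresponds]). Adjoining a scheme to the logic of [V] gives the
    logic of the members of [V] validating that scheme, so it remains to see
    that the join of [V(Cdp n)] and [V(D2)] consists of the algebras of [JIDL1]
    that validate the chain formula ([variety_joinP]).

    Algebra. These algebras form an equational class containing [Cdp n] and
    [D2], which gives one inclusion. For the other, let [A] be such an algebra.
    Prelinearity makes its implication Heyting; (JID) makes every [x′]
    complemented, with complement [x′^*]; it follows that the elements [x′] form
    a Boolean algebra on which [′] satisfies both De Morgan laws, and level 1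
    becomes [x ⊓ x′^* ≤ x′′]. Given [a <> b], put [c = (a ⇒ b) ⊓ (b ⇒ a)] and
    choose a prime filter [P] without [c′′ ⊓ c′^*], which is possible since
    this element lies below [c <> 1]. There are two cases.

    If some [d′] and [d′′] are both in [P], then [x ⊓ d′ ⊓ d′′ ≤ x′′] shows that
    all elements are complemented modulo [P], and [x] goes to [D2] by recording
    whether [x ∈ P] and whether [x′ ∉ P] ([prime_hom_D2]).

    Otherwise [F = {x | x′′ ∈ P}] is a prime filter such that exactly one of
    [x], [x′] is in [F]. The quotient by [F] is a chain, the chain formula
    bounds its size by [n], and sending each [x ∉ F] to the length of the
    longest chain below it is a homomorphism to [Cdp n] ([chain_hom]).

    Either homomorphism separates [a] from [b], so [A] embeds into a product of
    copies of [D2] and [Cdp n]. *)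

Set Implicit Arguments.
Unset Strict Implicit.
Unset Printing Implicit Defensive.

Local Notation "x ⊔ y" := (join x y) (at level 50, left associativity).
Local Notation "x ⊓ y" := (meet x y) (at level 40, left associativity).
Local Notation "x ⇒ y" := (imp x y) (at level 55, right associativity).
Local Notation "x ′" := (neg x) (at level 1, left associativity, format "x ′").
Local Notation "x ⊑ y" := (le x y) (at level 70, no associativity).
Local Notation "a ∨ b" := (Or a b) (at level 50, left associativity).
Local Notation "a ∧ b" := (And a b) (at level 40, left associativity).
Local Notation "a ⟶ b" := (Imp a b) (at level 55, right associativity).
Local Notation "∼ a" := (Neg a) (at level 35, right associativity).
Local Notation "a ⟶H b" := (ImpH a b) (at level 55, right associativity).

(** * Lattices and semi-Heyting algebras *)

Section Lattice.
Variables (A : algebra) (latA : is_bounded_lattice A).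
Implicit Types x y z : A.

Lemma joinC x y : x ⊔ y = y ⊔ x. Proof. by case: latA => -[]. Qed.
Lemma meetC x y : x ⊓ y = y ⊓ x. Proof. by case: latA => -[]. Qed.
Lemma joinA x y z : x ⊔ (y ⊔ z) = x ⊔ y ⊔ z.
Proof. by case: latA => _ []. Qed.
Lemma meetA x y z : x ⊓ (y ⊓ z) = x ⊓ y ⊓ z.
Proof. by case: latA => _ []. Qed.
Lemma joinKI x y : x ⊔ (x ⊓ y) = x. Proof. by case: latA => _ _ []. Qed.
Lemma meetKU x y : x ⊓ (x ⊔ y) = x. Proof. by case: latA => _ _ []. Qed.
Lemma joinx0 x : x ⊔ bot = x. Proof. by case: latA => _ _ _ []. Qed.
Lemma meetx1 x : x ⊓ top = x. Proof. by case: latA => _ _ _ []. Qed.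
Lemma meetxx x : x ⊓ x = x. Proof. by rewrite -{2}[x]joinx0 meetKU. Qed.
Lemma joinxx x : x ⊔ x = x. Proof. by rewrite -{2}[x]meetx1 joinKI. Qed.
Lemma meet0x x : bot ⊓ x = bot.
Proof. by rewrite -[x]joinx0 joinC meetKU. Qed.
Lemma meet1x x : top ⊓ x = x. Proof. by rewrite meetC meetx1. Qed.
Lemma join0x x : bot ⊔ x = x. Proof. by rewrite joinC joinx0. Qed.
Lemma join1x x : top ⊔ x = top. Proof. by rewrite -{1}[x]meet1x joinKI. Qed.

Lemma lexx x : x ⊑ x. Proof. exact: meetxx. Qed.
Lemma le_anti x y : x ⊑ y -> y ⊑ x -> x = y.
Proof. by move=> h1 h2; rewrite -[LHS]h1 meetC. Qed.
Lemma le_trans y x z : x ⊑ y -> y ⊑ z -> x ⊑ z.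
Proof. by rewrite /le => h1 h2; rewrite -{1}h1 -meetA h2. Qed.
Lemma le_joinE x y : x ⊑ y <-> x ⊔ y = y.
Proof.
rewrite /le; split=> [<-|<-]; last exact: meetKU.
by rewrite joinC meetC joinKI.
Qed.
Lemma leIl x y : x ⊓ y ⊑ x. Proof. by rewrite /le meetC meetA meetxx. Qed.
Lemma leIr x y : x ⊓ y ⊑ y. Proof. by rewrite meetC; apply: leIl. Qed.
Lemma lexI z x y : z ⊑ x -> z ⊑ y -> z ⊑ x ⊓ y.
Proof. by rewrite /le => h1 h2; rewrite meetA h1. Qed.
Lemma leUl x y : x ⊑ x ⊔ y. Proof. exact: meetKU. Qed.
Lemma leUr x y : y ⊑ x ⊔ y. Proof. by rewrite joinC; apply: leUl. Qed.
Lemma leUx x y z : x ⊑ z -> y ⊑ z -> x ⊔ y ⊑ z.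
Proof. by rewrite !le_joinE => h1 h2; rewrite -joinA h2. Qed.
Lemma le0x x : bot ⊑ x. Proof. exact: meet0x. Qed.
Lemma lex1 x : x ⊑ top. Proof. exact: meetx1. Qed.
Lemma leIx2 x y z : x ⊑ z -> x ⊓ y ⊑ z.
Proof. by apply: le_trans; apply: leIl. Qed.
Lemma leIx2r x y z : y ⊑ z -> x ⊓ y ⊑ z.
Proof. by apply: le_trans; apply: leIr. Qed.
Lemma le1x x : top ⊑ x -> x = top.
Proof. by move=> h; apply: le_anti => //; apply: lex1. Qed.

End Lattice.

(** The Heyting implication [x →_H y] of a semi-Heyting algebra. *)
Definition himp (A : algebra) (x y : A) : A := x ⇒ (x ⊓ y).

Section SemiHeyting.
Variables (A : algebra) (shA : is_semi_heyting A).
Implicit Types x y z : A.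

Lemma sh_lattice : is_bounded_lattice A. Proof. by case: shA. Qed.
Let L := sh_lattice.

Lemma sh_mp x y : x ⊓ (x ⇒ y) = x ⊓ y. Proof. by case: shA. Qed.
Lemma sh_rel x y z : x ⊓ (y ⇒ z) = x ⊓ ((x ⊓ y) ⇒ (x ⊓ z)).
Proof. by case: shA. Qed.
Lemma impxx x : x ⇒ x = top. Proof. by case: shA. Qed.

(** [→_H] is the residual of the meet, whatever the semi-Heyting implication. *)
Lemma le_himp x y z : z ⊑ himp x y <-> z ⊓ x ⊑ y.
Proof.
rewrite /himp; split=> h.
  have: z ⊓ x ⊑ (x ⇒ (x ⊓ y)) ⊓ x.
    by apply: (lexI L); [apply: (leIx2 L)|apply: (leIr L)].
  by rewrite (meetC L (_ ⇒ _) x) sh_mp => /(le_trans L); apply; do 2 apply: (leIx2r L);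
     apply: (lexx L).
by rewrite /le sh_rel (meetA L) (_ : z ⊓ x ⊓ y = z ⊓ x) // impxx (meetx1 L).
Qed.

Lemma himp1 x y : himp x y = top <-> x ⊑ y.
Proof.
split=> [h|h].
  by have /le_himp : top ⊑ himp x y; [rewrite h; apply: (lexx L)|rewrite (meet1x L)].
by apply: (le1x L); apply/le_himp; rewrite (meet1x L).
Qed.

Lemma himp_mp x y : himp x y ⊓ x ⊑ y.
Proof. by apply/le_himp; apply: (lexx L). Qed.

Lemma meetUr x y z : x ⊓ (y ⊔ z) = (x ⊓ y) ⊔ (x ⊓ z).
Proof.
apply: (le_anti L); last first.
  apply: (leUx L); apply: (lexI L); do ?exact: (leIl L); apply: (leIx2r L).
    exact: (leUl L).
  exact: (leUr L).
rewrite (meetC L); apply/le_himp; apply: (leUx L); apply/le_himp; rewrite (meetC L);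
  [exact: (leUl L)|exact: (leUr L)].
Qed.

(** The implication respects elements that agree below [w]. *)
Lemma meet_imp_congr w x y x1 y1 :
  w ⊓ x = w ⊓ x1 -> w ⊓ y = w ⊓ y1 -> w ⊓ (x ⇒ y) = w ⊓ (x1 ⇒ y1).
Proof. by move=> hx hy; rewrite sh_rel hx hy -sh_rel. Qed.

End SemiHeyting.

Section Soundness.
Variables (A : algebra) (HA : DHMSH A).
Implicit Types x y z : A.

Lemma DHMSH_sh : is_semi_heyting A. Proof. by case: HA. Qed.
Let S := DHMSH_sh.
Let L := sh_lattice S.

Lemma neg0 : (bot : A)′ = top. Proof. by case: HA. Qed.
Lemma neg1 : (top : A)′ = bot. Proof. by case: HA. Qed.
Lemma negI x y : (x ⊓ y)′ = x′ ⊔ y′. Proof. by case: HA. Qed.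
Lemma le_neg x y : x ⊑ y -> y′ ⊑ x′.
Proof. by rewrite {1}/le => <-; rewrite negI; apply: (leUr L). Qed.

Lemma eval_ImpH (v : nat -> A) a b :
  eval v (a ⟶H b) = himp (eval v a) (eval v b).
Proof. by []. Qed.

(** The value of [a ⟶H b] is [top] exactly when that of [a] is below that of
    [b]. *)
Lemma eval_ImpH1 (v : nat -> A) a b :
  eval v (a ⟶H b) = top <-> eval v a ⊑ eval v b.
Proof. exact: himp1. Qed.

Lemma dhmsh_axiom_valid a : dhmsh_axiom a -> valid A a.
Proof.
case=> [p q|p q|p q r|p q|p q r| |p|p q r|p q r|p q r|p q r| | |p q] v //;
  apply/eval_ImpH1; rewrite ?eval_ImpH /=; move: (eval v) => e.
- exact: (leUl L).
- exact: (leUr L).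
- apply/(le_himp S)/(le_himp S); rewrite (meetUr S); apply: (leUx L).
    by rewrite -(meetA L) (meetC L _ (e p)) (meetA L); apply: (leIx2 L);
       apply: (himp_mp S).
  by rewrite -(meetA L); apply: (leIx2r L); apply: (himp_mp S).
- exact: (leIl L).
- apply/(le_himp S)/(le_himp S); apply: (lexI L).
    by rewrite -(meetA L) (meetC L _ (e r)) (meetA L); apply: (leIx2 L);
       apply: (himp_mp S).
  by rewrite -(meetA L); apply: (leIx2r L); apply: (himp_mp S).
- exact: (le0x L).
- by apply/(le_himp S)/(le_himp S); rewrite -(meetA L); apply: (himp_mp S).
- apply/(le_himp S); rewrite (meetA L).
  by apply: (le_trans L) (himp_mp S _ _); apply: (lexI L);
    [apply: (leIx2 L); apply: (himp_mp S)|apply: (leIr L)].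
- apply/(le_himp S)/(le_himp S).
  set w := himp _ _ ⊓ himp _ _; apply: (le_trans L _ (leIr L w _)).
  rewrite (_ : w ⊓ _ = w ⊓ (e q ⇒ e r)); first exact: (lexx L).
  apply: (meet_imp_congr S) => //; apply: (le_anti L); apply: (lexI L);
    do ?exact: (leIl L); rewrite /w; last first.
    by rewrite -(meetA L); apply: (leIx2r L); apply: (himp_mp S).
  by rewrite (meetC L (himp _ _)) -(meetA L); apply: (leIx2r L); apply: (himp_mp S).
- apply/(le_himp S)/(le_himp S).
  set w := himp _ _ ⊓ himp _ _; apply: (le_trans L _ (leIr L w _)).
  rewrite (_ : w ⊓ _ = w ⊓ (e r ⇒ e p)); first exact: (lexx L).
  apply: (meet_imp_congr S) => //; apply: (le_anti L); apply: (lexI L);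
    do ?exact: (leIl L); rewrite /w.
    by rewrite -(meetA L); apply: (leIx2r L); apply: (himp_mp S).
  by rewrite (meetC L (himp _ _)) -(meetA L); apply: (leIx2r L); apply: (himp_mp S).
- by rewrite neg0; apply: (lexx L).
- by rewrite neg1; apply: (lexx L).
- by rewrite negI; apply: (lexx L).
Qed.

Lemma derives_sound E G (v : nat -> A) a :
  (forall b s, E b -> eval v (subst s b) = top) ->
  (forall b, G b -> eval v b = top) ->
  derives E G a -> eval v a = top.
Proof.
move=> hE hG; elim=> [b /hG //|b /dhmsh_axiom_valid //|b s /hE //|b c _ hb _|b c _].
  by move/eval_ImpH1; rewrite hb; apply: (le1x L).
by move/eval_ImpH1 => h; apply/eval_ImpH1; apply: le_neg.
Qed.

End Soundness.

Lemma eval_subst (A : algebra) (v : nat -> A) s a :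
  eval v (subst s a) = eval (fun i => eval v (s i)) a.
Proof. by elim: a => //= [a -> b ->|a -> b ->|a -> b ->|a ->]. Qed.

Lemma subst_Var a : subst Var a = a.
Proof. by elim: a => //= [a -> b ->|a -> b ->|a -> b ->|a ->]. Qed.

Lemma subst_comp s t a : subst t (subst s a) = subst (fun i => subst t (s i)) a.
Proof. by elim: a => //= [a -> b ->|a -> b ->|a -> b ->|a ->]. Qed.

Lemma scheme_theorem (E : schemes) a : E a -> theorem E a.
Proof. by move=> Ea; rewrite -(subst_Var a); apply: D_scheme. Qed.

Lemma theorem_sound (E : schemes) (A : algebra) : DHMSH A ->
  (forall b, E b -> valid A b) -> forall a, theorem E a -> valid A a.
Proof.
move=> HA hE a ha v; apply: derives_sound ha => // b s Eb.
by rewrite eval_subst; apply: hE.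
Qed.

(** * Derivations in the Hilbert calculus *)

Section Calculus.
Variables (E : schemes) (G : form -> Prop).
Local Notation "⊢ a" := (derives E G a) (at level 75).
Implicit Types a b c d p : form.

(** [below a b] is the order of the Lindenbaum algebra. *)
Definition below a b := ⊢ a ⟶H b.

Lemma ax a : dhmsh_axiom a -> ⊢ a. Proof. exact: D_axiom. Qed.
Lemma mp a b : ⊢ a -> below a b -> ⊢ b. Proof. exact: D_SMP. Qed.

Lemma Andl a b : below (a ∧ b) a. Proof. exact/ax/A4. Qed.
Lemma curry a b c : below (a ∧ b) c -> below a (b ⟶H c).
Proof. by move=> h; apply: mp h _; apply/ax/A8. Qed.
Lemma uncurry a b c : below a (b ⟶H c) -> below (a ∧ b) c.
Proof. by move=> h; apply: mp h _; apply/ax/A9. Qed.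
Lemma weaken p a : ⊢ p -> below a p.
Proof. by move=> h; apply: mp h _; apply: curry; apply: Andl. Qed.
Lemma below_And c a b : below c a -> below c b -> below c (a ∧ b).
Proof. by move=> ha hb; apply: mp hb _; apply: mp ha _; apply/ax/A5. Qed.

Lemma Imp_congl a b c : below a b -> below b a -> below (a ⟶ c) (b ⟶ c).
Proof. by move=> hab hba; apply: mp hba _; apply: mp hab _; apply/ax/A10. Qed.
Lemma Imp_congr a b c : below a b -> below b a -> below (c ⟶ a) (c ⟶ b).
Proof. by move=> hab hba; apply: mp hab _; apply: mp hba _; apply/ax/A11. Qed.

(** With [p] provable, [a ∧ p] and [a ∧ a] are interderivable, so
    [a ⟶H p], which is [a ⟶ a ∧ p], can be replaced by [a ⟶ a ∧ a]. *)
Lemma below_refl a : below a a.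
Proof.
have hp : ⊢ Top by apply/ax/A6.
have hT : below a Top := weaken a hp.
apply: mp hT _; apply: Imp_congr.
  by apply: below_And; apply: Andl.
by apply: below_And; [apply: Andl|apply: weaken].
Qed.

Lemma Andr a b : below (a ∧ b) b.
Proof. by apply: uncurry; apply: weaken; apply: below_refl. Qed.
Lemma AndC a b : below (a ∧ b) (b ∧ a).
Proof. by apply: below_And; [apply: Andr|apply: Andl]. Qed.

(** Transitivity is not an axiom: from [(a ∧ b) ⟶ (a ∧ b) ∧ c] one reaches
    [a ⟶ a ∧ c] by replacing interderivable formulas on both sides. *)
Lemma below_trans b a c : below a b -> below b c -> below a c.
Proof.
move=> hab hbc.
have habc : below (a ∧ b) c by apply: uncurry; apply: weaken.
have ha : below a (a ∧ b) by apply: below_And => //; apply: below_refl.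
have h1 : ⊢ a ⟶ ((a ∧ b) ∧ c).
  by apply: mp habc _; apply: Imp_congl => //; apply: Andl.
have h2 : ⊢ a ⟶ (c ∧ (a ∧ b)).
  by apply: mp h1 _; apply: Imp_congr; apply: AndC.
have h3 : ⊢ a ⟶ (c ∧ a).
  apply: mp h2 _; apply: Imp_congr; apply: below_And; try exact: Andl.
    by apply: uncurry; apply: weaken; apply: Andl.
  by apply: uncurry; apply: weaken.
by apply: mp h3 _; apply: Imp_congr; apply: AndC.
Qed.

Lemma Orl a b : below a (a ∨ b). Proof. exact/ax/A1. Qed.
Lemma Orr a b : below b (a ∨ b). Proof. exact/ax/A2. Qed.
Lemma Or_below a b c : below a c -> below b c -> below (a ∨ b) c.
Proof. by move=> ha hb; apply: mp hb _; apply: mp ha _; apply/ax/A3. Qed.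
Lemma Neg_below a b : below a b -> below (∼ b) (∼ a).
Proof. exact: D_SCP. Qed.

(** Equality in the Lindenbaum algebra. *)
Definition interd a b := below a b /\ below b a.

Lemma interd_refl a : interd a a. Proof. by split; apply: below_refl. Qed.
Lemma interd_sym a b : interd a b -> interd b a. Proof. by case. Qed.
Lemma interd_trans b a c : interd a b -> interd b c -> interd a c.
Proof.
by move=> [h1 h2] [h3 h4]; split; [apply: below_trans h3|apply: below_trans h2].
Qed.

Lemma And_mono a b c d : below a b -> below c d -> below (a ∧ c) (b ∧ d).
Proof.
by move=> h1 h2; apply: below_And;
  [apply: below_trans h1; apply: Andl|apply: below_trans h2; apply: Andr].
Qed.
Lemma Or_mono a b c d : below a b -> below c d -> below (a ∨ c) (b ∨ d).
Proof.
by move=> h1 h2; apply: Or_below;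
  [apply: below_trans (Orl _ _)|apply: below_trans (Orr _ _)].
Qed.

Lemma And_interd a b c d : interd a b -> interd c d -> interd (a ∧ c) (b ∧ d).
Proof. by move=> [? ?] [? ?]; split; apply: And_mono. Qed.
Lemma Or_interd a b c d : interd a b -> interd c d -> interd (a ∨ c) (b ∨ d).
Proof. by move=> [? ?] [? ?]; split; apply: Or_mono. Qed.
Lemma Neg_interd a b : interd a b -> interd (∼ a) (∼ b).
Proof. by move=> [? ?]; split; apply: Neg_below. Qed.
Lemma Imp_interd a b c d : interd a b -> interd c d -> interd (a ⟶ c) (b ⟶ d).
Proof.
move=> [? ?] [? ?]; split.
  by apply: (@below_trans (b ⟶ c)); [apply: Imp_congl|apply: Imp_congr].
by apply: (@below_trans (a ⟶ d)); [apply: Imp_congl|apply: Imp_congr].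
Qed.

Lemma below_mp a b : below (a ∧ (a ⟶H b)) b.
Proof.
by apply: below_trans (AndC _ _) _; apply: uncurry; apply: below_refl.
Qed.

(** Implications whose arguments agree below [p] agree below [p]. *)
Lemma And_Imp_congr p a b c d :
  below p (a ⟶H b) -> below p (b ⟶H a) ->
  below p (c ⟶H d) -> below p (d ⟶H c) ->
  below (p ∧ (a ⟶ c)) (b ⟶ d).
Proof.
have trans3 x y z q : below p x -> below p y ->
    dhmsh_axiom (x ⟶H (y ⟶H (z ⟶H q))) -> below (p ∧ z) q.
  move=> hx hy /ax h; apply: uncurry.
  apply: (@below_trans (p ∧ y)).
    by apply: below_And => //; apply: below_refl.
  by apply: uncurry; apply: below_trans h.
move=> hab hba hcd hdc.
have h1 : below (p ∧ (a ⟶ c)) (b ⟶ c) by apply: trans3 hab hba _; apply: A10.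
have h2 : below (p ∧ (b ⟶ c)) (b ⟶ d) by apply: trans3 hdc hcd _; apply: A11.
by apply: below_trans h2; apply: below_And => //; apply: Andl.
Qed.

Lemma Imp_refl a : ⊢ a ⟶ a.
Proof.
apply: mp (below_refl a) _; apply: Imp_congr; first exact: Andl.
by apply: below_And; apply: below_refl.
Qed.

Lemma And_Imp a b : interd (a ∧ (a ⟶ b)) (a ∧ b).
Proof.
have h1 : below a (b ⟶H (a ∧ b)) by apply: curry; apply: below_refl.
have h2 : below a ((a ∧ b) ⟶H b) by apply: weaken; apply: Andr.
have h3 : below a (a ⟶H a) by apply: weaken; apply: below_refl.
split.
  apply: below_And; first exact: Andl.
  apply: below_trans (below_mp a b).
  by apply: below_And; [apply: Andl|apply: And_Imp_congr].
apply: below_And; first exact: Andl.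
apply: (@below_trans (a ∧ (a ⟶ (a ∧ b)))); last exact: And_Imp_congr.
apply: below_And; first exact: Andl.
by apply: (@below_trans b); [apply: Andr|apply: curry; apply: Andl].
Qed.

Lemma And_Imp_rel a b c : interd (a ∧ (b ⟶ c)) (a ∧ ((a ∧ b) ⟶ (a ∧ c))).
Proof.
have h1 d : below a (d ⟶H (a ∧ d)) by apply: curry; apply: below_refl.
have h2 d : below a ((a ∧ d) ⟶H d) by apply: weaken; apply: Andr.
by split; apply: below_And; do ?exact: Andl; apply: And_Imp_congr.
Qed.

End Calculus.

(** * Completeness: the Lindenbaum algebra *)

Section Lindenbaum.
Variables (E : schemes) (G : form -> Prop).
Local Notation "⊢ a" := (derives E G a) (at level 75).
Local Notation "a ≈ b" := (interd E G a b) (at level 70).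

(** An equivalence class of formulas is represented as the predicate that it
    defines, so that equality of classes is Leibniz equality. *)
Definition form_class := {P : form -> Prop | exists a, P = interd E G a}.
Definition class_of (a : form) : form_class :=
  exist _ (interd E G a) (ex_intro _ a erefl).
(** A formula chosen in the class [x]. *)
Definition repr (x : form_class) : form := sval (cid (proj2_sig x)).

Lemma class_ofP a b : class_of a = class_of b <-> a ≈ b.
Proof.
split=> [[h]|h]; first by rewrite h; apply: interd_refl.
apply: eq_exist; apply: funext => c; apply: propext; split=> hc.
  exact: interd_trans (interd_sym h) hc.
exact: interd_trans h hc.
Qed.

Lemma reprK x : class_of (repr x) = x.
Proof.
rewrite /repr; case: cid => a; case: x => P [b hb] /= eP.
by apply: eq_exist; rewrite eP.
Qed.

Lemma repr_class a : repr (class_of a) ≈ a.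
Proof. by apply/class_ofP; rewrite reprK. Qed.

(** Formulas modulo interderivability from the premises [G]. *)
Definition Lindenbaum : algebra := {|
  carrier := form_class;
  join := fun x y => class_of (repr x ∨ repr y);
  meet := fun x y => class_of (repr x ∧ repr y);
  imp := fun x y => class_of (repr x ⟶ repr y);
  neg := fun x => class_of (∼ repr x);
  bot := class_of Bot;
  top := class_of Top |}.

(** [class_of], seen as a map to the algebra. *)
Definition cls (a : form) : Lindenbaum := class_of a.

Lemma clsP (x : Lindenbaum) : exists a, x = cls a.
Proof. by exists (repr x); rewrite /cls reprK. Qed.
Lemma cls_eq a b : cls a = cls b <-> a ≈ b. Proof. exact: class_ofP. Qed.
Lemma cls_Or a b : cls a ⊔ cls b = cls (a ∨ b).
Proof. by apply/cls_eq; apply: Or_interd; apply: repr_class. Qed.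
Lemma cls_And a b : cls a ⊓ cls b = cls (a ∧ b).
Proof. by apply/cls_eq; apply: And_interd; apply: repr_class. Qed.
Lemma cls_Imp a b : (cls a ⇒ cls b) = cls (a ⟶ b).
Proof. by apply/cls_eq; apply: Imp_interd; apply: repr_class. Qed.
Lemma cls_Neg a : (cls a)′ = cls (∼ a).
Proof. by apply/cls_eq; apply: Neg_interd; apply: repr_class. Qed.
Definition clsE := (cls_Or, cls_And, cls_Imp, cls_Neg).

Lemma cls_top a : cls a = top <-> ⊢ a.
Proof.
have hT : ⊢ Top by apply/ax/A6.
split=> [/cls_eq [_ h]|h]; first exact: mp hT h.
by apply/cls_eq; split; apply: weaken.
Qed.

Lemma Lindenbaum_lattice : is_bounded_lattice Lindenbaum.
Proof.
split; split.
- move=> x y; case: (clsP x) (clsP y) => [a ->] [b ->]; rewrite !clsE.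
  by apply/cls_eq; split; apply: Or_below; do ?exact: Orl; apply: Orr.
- move=> x y; case: (clsP x) (clsP y) => [a ->] [b ->]; rewrite !clsE.
  by apply/cls_eq; split; apply: AndC.
- move=> x y z; case: (clsP x) (clsP y) (clsP z) => [a ->] [b ->] [c ->].
  rewrite !clsE; apply/cls_eq; split; apply: Or_below.
  + by apply: below_trans (Orl _ _ _ _); apply: Orl.
  + apply: Or_below; last exact: Orr.
    by apply: below_trans (Orl _ _ _ _); apply: Orr.
  + apply: Or_below; first exact: Orl.
    by apply: below_trans (Orr _ _ _ _); apply: Orl.
  + by apply: below_trans (Orr _ _ _ _); apply: Orr.
- move=> x y z; case: (clsP x) (clsP y) (clsP z) => [a ->] [b ->] [c ->].
  rewrite !clsE; apply/cls_eq; split; apply: below_And.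
  + apply: below_And; first exact: Andl.
    by apply: below_trans (Andr _ _ _ _) _; apply: Andl.
  + by apply: below_trans (Andr _ _ _ _) _; apply: Andr.
  + by apply: below_trans (Andl _ _ _ _) _; apply: Andl.
  + apply: below_And; last exact: Andr.
    by apply: below_trans (Andl _ _ _ _) _; apply: Andr.
- move=> x y; case: (clsP x) (clsP y) => [a ->] [b ->]; rewrite !clsE.
  apply/cls_eq; split; last exact: Orl.
  by apply: Or_below; [apply: below_refl|apply: Andl].
- move=> x y; case: (clsP x) (clsP y) => [a ->] [b ->]; rewrite !clsE.
  apply/cls_eq; split; first exact: Andl.
  by apply: below_And; [apply: below_refl|apply: Orl].
- move=> x; case: (clsP x) => [a ->]; rewrite (cls_Or a Bot).
  apply/cls_eq; split; last exact: Orl.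
  by apply: Or_below; [apply: below_refl|apply/ax/A7].
- move=> x; case: (clsP x) => [a ->]; rewrite (cls_And a Top).
  apply/cls_eq; split; first exact: Andl.
  by apply: below_And; [apply: below_refl|apply: weaken; apply/ax/A6].
Qed.

Lemma Lindenbaum_DHMSH : DHMSH Lindenbaum.
Proof.
split; last 1 first.
- move=> x y; case: (clsP x) (clsP y) => [a ->] [b ->]; rewrite !clsE.
  apply/cls_eq; split; first exact/ax/A14.
  by apply: Or_below; apply: Neg_below; [apply: Andl|apply: Andr].
- split; first exact: Lindenbaum_lattice.
  + move=> x y; case: (clsP x) (clsP y) => [a ->] [b ->]; rewrite !clsE.
    by apply/cls_eq; apply: And_Imp.
  + move=> x y z; case: (clsP x) (clsP y) (clsP z) => [a ->] [b ->] [c ->].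
    by rewrite !clsE; apply/cls_eq; apply: And_Imp_rel.
  + move=> x; case: (clsP x) => [a ->]; rewrite cls_Imp.
    by apply/cls_top; apply: Imp_refl.
- rewrite (cls_Neg Bot); apply/cls_eq; split; last exact/ax/A12.
  by apply: weaken; apply/ax/A6.
- rewrite (cls_Neg Top); apply/cls_eq; split; first exact/ax/A13.
  exact/ax/A7.
Qed.

Lemma eval_Lindenbaum (s : nat -> form) a :
  eval (fun i => cls (s i)) a = cls (subst s a).
Proof.
elim: a => // [a IHa b IHb|a IHa b IHb|a IHa b IHb|a IHa]; rewrite [subst _ _]/=.
- by rewrite -cls_Or -IHa -IHb.
- by rewrite -cls_And -IHa -IHb.
- by rewrite -cls_Imp -IHa -IHb.
- by rewrite -cls_Neg -IHa.
Qed.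

Lemma theorem_subst a s : theorem E a -> ⊢ subst s a.
Proof.
rewrite /theorem => h; elim: h => {a} // [a ha|a t Ea|a b _ h1 _ h2|a b _ h].
- by apply: D_axiom; case: ha => *; constructor.
- by rewrite subst_comp; apply: D_scheme.
- exact: D_SMP h1 h2.
- exact: D_SCP h.
Qed.

Lemma Lindenbaum_valid a : theorem E a -> valid Lindenbaum a.
Proof.
move=> ha v.
have -> : v = fun i => cls (repr (v i)).
  by apply: funext => i; rewrite /cls reprK.
by rewrite eval_Lindenbaum; apply/cls_top; apply: theorem_subst.
Qed.

End Lindenbaum.

(** Derivability is semantic consequence over the algebras of [DHMSH] in which
    the theorems are valid; in particular that class determines the logic. *)
Theorem derivesP E G a :
  derives E G a <->
  (forall A : algebra, DHMSH A -> (forall b, theorem E b -> valid A b) ->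
   forall v : nat -> A, (forall b, G b -> eval v b = top) -> eval v a = top).
Proof.
split=> [ha A HA hE v hG|h].
  by apply: derives_sound ha => // b s Eb; apply: hE; apply: D_scheme.
have := h _ (Lindenbaum_DHMSH E G) (@Lindenbaum_valid E G) (cls E G \o Var).
rewrite (eval_Lindenbaum E G Var) subst_Var => h1; apply/cls_top; apply: h1 => b Gb.
by rewrite (eval_Lindenbaum E G Var) subst_Var; apply/cls_top; apply: D_premise.
Qed.

Lemma corresponds_same_logic V E F :
  corresponds V E -> corresponds V F -> same_logic F E.
Proof.
have sub E1 F1 G a : corresponds V E1 -> corresponds V F1 ->
    derives F1 G a -> derives E1 G a.
  move=> hE hF /derivesP ha; apply/derivesP => A HA hA.
  have [HA' hA'] : DHMSH A /\ (forall b, theorem F1 b -> valid A b).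
    by apply/hF; apply/hE.
  exact: ha.
by move=> hE hF G a; split; apply: sub.
Qed.

Lemma corresponds_is_logic_of V E : corresponds V E -> is_logic_of V E.
Proof. by move=> hE; split=> // F; apply: corresponds_same_logic. Qed.

(** * Equational classes *)

(** The pair [(s, t)] stands for the equation [s ≈ t]. *)
Definition satisfies (A : algebra) (e : form * form) : Prop :=
  forall v : nat -> A, eval v e.1 = eval v e.2.

(** [A] satisfies all the equations of the list [L]. *)
Fixpoint models (L : seq (form * form)) (A : algebra) : Prop :=
  if L is e :: L' then satisfies A e /\ models L' A else True.

Lemma eval_hom (A B : algebra) (f : A -> B) (v : nat -> A) a :
  is_hom f -> eval (f \o v) a = f (eval v a).
Proof.
case=> -[hj hm] hi hn [h0 h1].
by elim: a => //= [a -> b ->|a -> b ->|a -> b ->|a ->]; rewrite ?hj ?hm ?hi ?hn.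
Qed.

Lemma eval_product (I : Type) (A : I -> algebra) (v : nat -> product A) a i :
  eval v a i = eval (fun k => v k i) a.
Proof. by elim: a => //= [a -> b ->|a -> b ->|a -> b ->|a ->]. Qed.

Lemma models_variety L : is_variety (models L).
Proof.
split.
- move=> A B f + hf sf; elim: L => //= e L IH [he /IH hL]; split=> // v.
  have /choice [g hg] : forall i, exists a, f a = v i by move=> i; apply: sf.
  have -> : v = f \o g by apply: funext => i; rewrite /= hg.
  by rewrite !(eval_hom _ _ hf) he.
- move=> A B f + hf sf; elim: L => //= e L IH [he /IH hL]; split=> // v.
  by apply: sf; rewrite -!(eval_hom _ _ hf) he.
- move=> I A; elim: L => //= e L IH h; split.
    move=> v; apply: functional_extensionality_dep => i; rewrite !eval_product.
    by case: (h i) => he _; apply: he.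
  by apply: IH => i; case: (h i).
Qed.

Lemma models_cat L1 L2 A : models (L1 ++ L2) A <-> models L1 A /\ models L2 A.
Proof.
elim: L1 => [|e L1 IH] /=; first by split=> [|[]].
split=> [[he /IH [h1 h2]]|[[he h1] h2]]; first by split.
by split=> //; apply/IH.
Qed.

(** The formulas valid in a subvariety of [DHMSH] present its logic: over
    [DHMSH] an equation [s ≈ t] amounts to [s ⟶H t] and [t ⟶H s]. *)
Lemma equational_corresponds (V : algebra_class) L :
  (forall A, V A <-> DHMSH A /\ models L A) ->
  corresponds V (fun a => forall A, V A -> valid A a).
Proof.
move=> hV A; set E := fun a => _; split=> [VA|[HA hA]].
  have [HA _] := (hV A).1 VA.
  by split=> //; apply: theorem_sound => // b Eb; apply: Eb.
apply/hV; split=> //.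
have hE s t : (forall B, V B -> satisfies B (s, t)) -> satisfies A (s, t).
  have S := DHMSH_sh HA; have La := sh_lattice S.
  move=> hst v; apply: (le_anti La); apply/(eval_ImpH1 HA); apply: hA;
    apply: scheme_theorem => B VB w; have SB := DHMSH_sh ((hV B).1 VB).1;
    apply/(eval_ImpH1 ((hV B).1 VB).1); have := hst B VB w => /= ->;
    exact: (lexx (sh_lattice SB)).
have : forall B, V B -> models L B by move=> B /hV [].
elim: L {hV} => //= -[s t] L IH hL; split.
  by apply: hE => B /hL [].
by apply: IH => B /hL [].
Qed.

Section Equations.
Let x := Var 0.
Let y := Var 1.
Let z := Var 2.
(* [q a] is the term a′^* *)
Let q (a : form) := ∼ a ⟶ Bot.

(** Equations defining [DHMSH]. *)
Definition DHMSH_eqs : seq (form * form) :=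
  [:: (x ∨ y, y ∨ x); (x ∧ y, y ∧ x);
      (x ∨ (y ∨ z), x ∨ y ∨ z); (x ∧ (y ∧ z), x ∧ y ∧ z);
      (x ∨ (x ∧ y), x); (x ∧ (x ∨ y), x);
      (x ∨ Bot, x); (x ∧ Top, x);
      (x ∧ (x ⟶ y), x ∧ y);
      (x ∧ (y ⟶ z), x ∧ ((x ∧ y) ⟶ (x ∧ z)));
      (x ⟶ x, Top); (∼ Bot, Top); (∼ Top, Bot);
      (∼ (x ∧ y), ∼ x ∨ ∼ y)].

(** Equations defining [JIDL1] within [DHMSH]. *)
Definition JIDL1_eqs : seq (form * form) :=
  [:: (∼ ∼ (x ∨ y), ∼ ∼ x ∨ ∼ ∼ y); (∼ ∼ ∼ x, ∼ x); (∼ ∼ x ∧ x, ∼ ∼ x);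
      (∼ x ∨ (y ⟶ z), (∼ x ∨ y) ⟶ (∼ x ∨ z));
      (x ∧ q x, x ∧ q x ∧ q (q x));
      ((x ⟶ y) ∨ (y ⟶ x), Top)].

Lemma DHMSHP A : DHMSH A <-> models DHMSH_eqs A.
Proof.
split=> [[[[[? ?] [? ?] [? ?] [? ?]] ? ? ?] ? ? ?]|].
  by do ![apply: conj]; rewrite // /satisfies /=; auto.
case=> h1 [h2 [h3 [h4 [h5 [h6 [h7 [h8 [h9 [h10 [h11 [h12 [h13 [h14 _]]]]]]]]]]]]].
pose v (a b c : A) i := nth a [:: a; b; c] i.
split=> [|||a b].
- split=> [|a b|a b c|a].
  + split; split.
    * by move=> a b; apply: (h1 (v a b b)).
    * by move=> a b; apply: (h2 (v a b b)).
    * by move=> a b c; apply: (h3 (v a b c)).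
    * by move=> a b c; apply: (h4 (v a b c)).
    * by move=> a b; apply: (h5 (v a b b)).
    * by move=> a b; apply: (h6 (v a b b)).
    * by move=> a; apply: (h7 (v a a a)).
    * by move=> a; apply: (h8 (v a a a)).
  + exact: (h9 (v a b b)).
  + exact: (h10 (v a b c)).
  + exact: (h11 (v a a a)).
- exact: (h12 (fun=> bot)).
- exact: (h13 (fun=> bot)).
- exact: (h14 (v a b b)).
Qed.

(** By [DHMSHP], [JIDL1] is an equational class. *)
Lemma JIDL1P A : JIDL1 A <-> DHMSH A /\ models JIDL1_eqs A.
Proof.
split=> [[[HA ? ? h] ? ? ?]|].
  rewrite /le in h.
  by do ![apply: conj]; rewrite // /satisfies /=; auto.
case=> HA [h1 [h2 [h3 [h4 [h5 [h6 _]]]]]].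
pose v (a b c : A) i := nth a [:: a; b; c] i.
split=> [|a b c|a|a b].
- split=> // [a b|a|a].
  + exact: (h1 (v a b b)).
  + exact: (h2 (v a a a)).
  + exact: (h3 (v a a a)).
- exact: (h4 (v a b c)).
- exact: (h5 (v a a a)).
- exact: (h6 (v a b b)).
Qed.

End Equations.

(** * The chains and the four-element algebra *)

Section ChainForm.
Variables (A : algebra) (v : nat -> A).

Lemma le_foldl_Or (latA : is_bounded_lattice A) (f : nat -> form) s a :
  eval v a ⊑ eval v (foldl Or a [seq f i | i <- s]) /\
  (forall i, i \in s -> eval v (f i) ⊑ eval v (foldl Or a [seq f i | i <- s])).
Proof.
elim: s a => [|j s IH] a /=; first by split=> //; apply: (lexx latA).
have [h1 h2] := IH (a ∨ f j); split=> [|i].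
  by apply: (le_trans latA) h1; apply: (leUl latA).
rewrite inE => /orP[/eqP->|/h2//].
by apply: (le_trans latA) h1; apply: (leUr latA).
Qed.

Lemma chain_form_ge (latA : is_bounded_lattice A) n : 0 < n ->
  (forall i, i < n -> v i ⊑ eval v (chain_form n)) /\
  (forall i, i.+1 < n -> (v i ⇒ v i.+1) ⊑ eval v (chain_form n)).
Proof.
rewrite /chain_form foldl_cat => n0.
have [h1 h2] := le_foldl_Or latA Var (iota 1 n.-1) (Var 0).
have [h3 h4] := le_foldl_Or latA (fun i => Var i ⟶ Var i.+1) (iota 0 n.-1)
  (foldl Or (Var 0) [seq Var i | i <- iota 1 n.-1]).
split=> i hi; last by apply: h4; rewrite mem_iota; lia.
apply: (le_trans latA) h3; case: i hi => [//|i] hi.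
by apply: h2; rewrite mem_iota; lia.
Qed.

(** A join-prime predicate holding at the chain formula holds at a disjunct. *)
Lemma chain_form_prime (P : A -> Prop) n : 0 < n ->
  (forall x y, P (x ⊔ y) -> P x \/ P y) -> P (eval v (chain_form n)) ->
  (exists2 i, i < n & P (v i)) \/ (exists2 i, i.+1 < n & P (v i ⇒ v i.+1)).
Proof.
move=> n0 hP.
have main (f : nat -> form) s a : P (eval v (foldl Or a [seq f i | i <- s])) ->
    P (eval v a) \/ exists2 i, i \in s & P (eval v (f i)).
  elim: s a => [|j s IH] a /=; first by left.
  case/IH=> [/hP [|hj]|[i si hi]]; [by left| |].
    by right; exists j => //; rewrite inE eqxx.
  by right; exists i => //; rewrite inE si orbT.
rewrite /chain_form foldl_cat.
case/main=> [/main [h|[i]]|[i]]; rewrite ?mem_iota.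
- by left; exists 0.
- by move=> hi h; left; exists i => //; lia.
- by move=> hi h; right; exists i => //; lia.
Qed.

End ChainForm.

Section Chains.
Variable n : nat.
Hypothesis hn : 2 <= n.
Implicit Types x y z : Cdp n.

Let val_join x y : val (x ⊔ y) = maxn (val x) (val y).
Proof. by rewrite /=; case: ifP; lia. Qed.
Let val_meet x y : val (x ⊓ y) = minn (val x) (val y).
Proof. by rewrite /=; case: ifP; lia. Qed.
Let val_imp x y : val (x ⇒ y) = if val x <= val y then n.-1 else val y.
Proof. by rewrite /=; case: ifP. Qed.
Let val_neg x : val x′ = if val x == n.-1 then 0 else n.-1.
Proof. by rewrite /= -(inj_eq val_inj) /=; case: ifP. Qed.
Let val_bot : val (bot : Cdp n) = 0. Proof. by []. Qed.
Let val_top : val (top : Cdp n) = n.-1. Proof. by []. Qed.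
Let valE := (val_join, val_meet, val_imp, val_neg, val_bot, val_top).
Let val_lt x : val x <= n.-1. Proof. by rewrite -ltnS; case: x. Qed.

Ltac chain_eq :=
  move=> *; rewrite /pc /le; apply: val_inj; rewrite !valE;
  repeat match goal with x : carrier (Cdp _) |- _ =>
    move: (val_lt x); move: (val x) => {x}?; move=> ? end;
  repeat case: ifP; lia.

Lemma Cdp_DHMSH : DHMSH (Cdp n).
Proof. split; [split; [do 2!split|..]|..]; chain_eq. Qed.

Lemma Cdp_JIDL1 : JIDL1 (Cdp n).
Proof. by split; [split; [exact: Cdp_DHMSH|..]|..]; chain_eq. Qed.

(** Otherwise [v 0 > v 1 > ... > v (n - 1)] would be [n] elements below the
    top of an [n]-element chain. *)
Lemma Cdp_chain_form : valid (Cdp n) (chain_form n).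
Proof.
move=> v; have latC := sh_lattice (DHMSH_sh Cdp_DHMSH).
have [h1 h2] := chain_form_ge v latC (ltnW hn).
move: (eval _ _) h1 h2 => e h1 h2; apply: contrapT => he.
have le_val x : x ⊑ e -> val x < n.-1.
  move=> /(congr1 val); rewrite val_meet => hx.
  have := val_lt x; have := val_lt e; have : val e <> n.-1 by move=> h; apply/he/val_inj.
  by lia.
have v0 : val (v 0) < n.-1 by apply/le_val/h1; lia.
have dec i : i < n -> val (v i) + i <= val (v 0).
  elim: i => [|i IH] hi; first by rewrite addn0.
  have := IH (ltnW hi); have := le_val _ (h2 _ hi); rewrite val_imp.
  have := le_val _ (h1 i (ltnW hi)).
  by case: ifP; lia.
by have := dec n.-1; lia.
Qed.

End Chains.

Lemma D2_DHMSH : DHMSH D2.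
Proof.
by split; [split; [do 2!split|..]|..]; do ?case=> [[] []].
Qed.

Lemma D2_JIDL1 : JIDL1 D2.
Proof.
by split; [split; [exact: D2_DHMSH|..]|..]; rewrite /le /pc; do ?case=> [[] []].
Qed.

Lemma D2_chain_form n : 2 <= n -> valid D2 (chain_form n).
Proof.
move=> hn v; have latD := sh_lattice (DHMSH_sh D2_DHMSH).
have [h1 h2] := chain_form_ge v latD (ltnW hn).
have := h2 0 hn; have := h1 0 (ltnW hn); rewrite /le.
by move: (eval _ _) (v 0) (v 1) => [[] []] [[] []] [[] []].
Qed.

(** * The structure of JIDL1-algebras *)

Section JIDL1Theory.
Variables (A : algebra) (HJ : JIDL1 A).
Implicit Types x y z w d : A.

Let HA : DHMSH A. Proof. by case: HJ => -[]. Qed.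
Let S := DHMSH_sh HA.
Let L := sh_lattice S.


Lemma prelinear x y : (x ⇒ y) ⊔ (y ⇒ x) = top. Proof. by case: HJ. Qed.
Lemma negD2 x y : (x ⊔ y)′′ = x′′ ⊔ y′′. Proof. by case: HJ => -[]. Qed.
Lemma neg3 x : x′′′ = x′. Proof. by case: HJ => -[]. Qed.
Lemma neg2_le x : x′′ ⊑ x. Proof. by case: HJ => -[]. Qed.
Lemma JID x y z : x′ ⊔ (y ⇒ z) = (x′ ⊔ y) ⇒ (x′ ⊔ z).
Proof. by case: HJ. Qed.

(** In a semi-Heyting algebra, [x ⊑ y] alone does not give [x ⇒ y = 1]. *)
Lemma le_imp1 x y : x ⊑ y -> (x ⇒ y) = top.
Proof.
move=> hxy; set w := y ⇒ x.
have hyx : w ⊓ y = x.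
  by rewrite (meetC L) (sh_mp S) (meetC L).
have hxw : w ⊓ x = x by rewrite -hyx (meetA L) (meetxx L).
have hw : w ⊑ x ⇒ y.
  by rewrite /le (sh_rel S) hyx hxw (impxx S) (meetx1 L).
by have := prelinear x y; rewrite (joinC L) ((le_joinE L _ _).1 hw).
Qed.

(** Prelinearity forces the semi-Heyting implication to be Heyting. *)
Lemma imp_himp x y : (x ⇒ y) = himp x y.
Proof.
apply: (le_anti L).
  by apply/(le_himp S); rewrite (meetC L) (sh_mp S); apply: (leIr L).
set w := himp x y; rewrite /le (sh_rel S).
have h : w ⊓ x ⊑ w ⊓ y.
  by apply: (lexI L); [apply: (leIl L)|apply: (himp_mp S)].
by rewrite (le_imp1 h) (meetx1 L).
Qed.

Lemma le_imp x y z : z ⊑ (x ⇒ y) <-> z ⊓ x ⊑ y.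
Proof. by rewrite imp_himp; apply: le_himp. Qed.

Lemma imp_mp x y : (x ⇒ y) ⊓ x ⊑ y.
Proof. by rewrite (meetC L) (sh_mp S); apply: (leIr L). Qed.

Lemma meet_pc x : x ⊓ pc x = bot.
Proof. by rewrite /pc (sh_mp S) (meetC L) (meet0x L). Qed.

Lemma pc_unique x y : x ⊔ y = top -> x ⊓ y = bot -> pc x = y.
Proof.
move=> h1 h2; apply: (le_anti L); last first.
  by apply/le_imp; rewrite (meetC L) h2; apply: (lexx L).
rewrite -[pc x](meetx1 L) -h1 (meetUr S) (meetC L _ x) meet_pc (join0x L).
exact: (leIr L).
Qed.

(** By JID, every [x′] is complemented. *)
Lemma neg_compl x : x′ ⊔ pc x′ = top.
Proof. by rewrite /pc JID (joinxx L) (joinx0 L) (impxx S). Qed.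

Lemma pc_pc_neg x : pc (pc x′) = x′.
Proof.
by apply: pc_unique; [rewrite (joinC L) neg_compl|rewrite (meetC L) meet_pc].
Qed.

Lemma neg2_join_pc x : x′′ ⊔ (pc x′)′ = top.
Proof. by rewrite -(negI HA) meet_pc (neg0 HA). Qed.

Lemma pc_neg_regular x : (pc x′)′′ = pc x′.
Proof.
apply: (le_anti L); first exact: neg2_le.
have h : x′ ⊔ (pc x′)′′ = top.
  by rewrite -{1}(neg3 x) -negD2 neg_compl (neg1 HA) (neg0 HA).
rewrite -{1}[pc x′](meetx1 L) -h (meetUr S) (meetC L _ x′) meet_pc (join0x L).
exact: (leIr L).
Qed.

Lemma pcU x y : pc (x ⊔ y) = pc x ⊓ pc y.
Proof.
apply: (le_anti L).
  apply: (lexI L); apply/le_imp; rewrite -(meet_pc (x ⊔ y)) (meetC L (x ⊔ y));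
    apply: (lexI L); do ?exact: (leIl L); apply: (leIx2r L);
    [exact: (leUl L)|exact: (leUr L)].
apply/le_imp; rewrite (meetUr S); apply: (leUx L).
  rewrite -(meet_pc x) (meetC L x); apply: (lexI L); last exact: (leIr L).
  by apply: (leIx2 L); apply: (leIl L).
rewrite -(meet_pc y) (meetC L y); apply: (lexI L); last exact: (leIr L).
by apply: (leIx2 L); apply: (leIr L).
Qed.

(** The elements [x′] are closed under complements and joins, hence under
    meets; so [′] satisfies both De Morgan laws. *)
Lemma negU x y : (x ⊔ y)′ = x′ ⊓ y′.
Proof.
have [z hz] : exists z, x′ ⊓ y′ = pc z′.
  exists ((pc x′)′ ⊓ (pc y′)′).
  by rewrite (negI HA) !pc_neg_regular pcU !pc_pc_neg.
by rewrite hz -(pc_neg_regular z) -hz (negI HA) -negD2 neg3.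
Qed.

Lemma neg2I x y : (x ⊓ y)′′ = x′′ ⊓ y′′.
Proof. by rewrite (negI HA) negU. Qed.

Lemma neg_pc_neg x : (pc x′)′ = pc x′′.
Proof.
apply/esym/pc_unique; first exact: neg2_join_pc.
by rewrite -negU neg_compl (neg1 HA).
Qed.

(** The level 1 identity, simplified. *)
Lemma level1 x : x ⊓ pc x′ ⊑ x′′.
Proof.
case: HJ => _ _ h _; rewrite h neg_pc_neg pc_pc_neg; exact: (leIr L).
Qed.

(** Level 1 at [x ⊔ d′′*]. *)
Lemma meet_neg_neg2_le x d : x ⊓ d′ ⊓ d′′ ⊑ x′′.
Proof.
have h := level1 (x ⊔ pc d′′).
rewrite negD2 pc_neg_regular negU neg_pc_neg neg3 in h.
have hd : d′ ⊑ pc (x′ ⊓ pc d′).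
  apply/le_imp; rewrite (meetC L x′) (meetA L) meet_pc (meet0x L).
  exact: (lexx L).
have {hd}h : x ⊓ d′ ⊑ x′′ ⊔ pc d′′.
  apply: (le_trans L) h; apply: (lexI L).
    by apply: (leIx2 L); apply: (leUl L).
  exact: (leIx2r L).
have : x ⊓ d′ ⊓ d′′ ⊑ d′′ ⊓ (x′′ ⊔ pc d′′).
  by apply: (lexI L); [apply: (leIr L)|apply: (leIx2 L)].
rewrite (meetUr S) meet_pc (joinx0 L) => /(le_trans L); apply; exact: (leIr L).
Qed.

(** ** Prime filters *)

(** Proper prime filters of [A], as predicates. *)
Definition prime_filter (P : A -> Prop) : Prop :=
  [/\ P top, ~ P bot,
      forall x y, P (x ⊓ y) <-> P x /\ P y &
      forall x y, P (x ⊔ y) <-> P x \/ P y].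

(** A filter maximal among those without [e] is prime, by distributivity. *)
Lemma prime_filter_avoiding e : e <> top -> exists2 P, prime_filter P & ~ P e.
Proof.
move=> e1.
(* the empty set is admitted, so that the empty chain has an upper bound *)
pose ok (X : set A) := [/\ forall x y, X x -> x ⊑ y -> X y,
  forall x y, X x -> X y -> X (x ⊓ y) & ~ X e].
have [F Fok totF|M [[Mup MI Me] Mmax]] := @Zorn_bigcup A ok.
  split=> [x y [X FX Xx] xy|x y [X FX Xx] [Y FY Yy]|[X FX Xe]].
  - by exists X => //; case: (Fok _ FX) => h _ _; apply: h xy.
  - case: (totF _ _ FX FY) => sub.
      by exists Y => //; case: (Fok _ FY) => _ h _; apply: h => //; apply: sub.
    by exists X => //; case: (Fok _ FX) => _ h _; apply: h => //; apply: sub.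
  - by case: (Fok _ FX).
(* the filter generated by [M] and [x] *)
pose ext x : set A := fun y => exists2 m, M m \/ m = top & m ⊓ x ⊑ y.
have extP x : ~ M x -> ext x e.
  move=> nMx; apply: contrapT => nxe; apply: (Mmax (ext x)).
    split; last by move=> /(_ x); apply: contra_not nMx; apply; exists top;
      [right|rewrite (meet1x L); apply: (lexx L)].
    by move=> m Mm; exists m; [left|apply: (leIl L)].
  split=> // [y z [m hm hy] yz|y z [m hm hy] [k hk hz]].
    by exists m => //; apply: (le_trans L) yz.
  exists (m ⊓ k); last first.
    apply: (lexI L).
      by apply: (le_trans L) hy; rewrite (meetC L m) -(meetA L); apply: (leIr L).
    by apply: (le_trans L) hz; rewrite -(meetA L); apply: (leIr L).
  case: hm hk => [Mm [Mk|->]|-> [Mk|->]]; rewrite ?(meetx1 L) ?(meet1x L);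
    by [left; apply: MI|left|right].
have M1 : M top.
  apply: contrapT => nM1; have [k [Mk|k1] hk] := extP top nM1; rewrite (meetx1 L) in hk.
    exact/Me/(Mup k).
  by apply: e1; apply: (le1x L); rewrite -k1.
have extM x : ~ M x -> exists2 m, M m & m ⊓ x ⊑ e.
  by move=> /extP [m [Mm|->] hm]; [exists m|exists top].
exists M => //; split=> // [M0|x y|x y].
- by apply: Me; apply: Mup M0 _; apply: (le0x L).
- split=> [Mxy|[]]; last exact: MI.
  by split; apply: Mup Mxy _; [apply: (leIl L)|apply: (leIr L)].
- split=> [Mxy|[Mx|My]]; last first.
  + by apply: Mup My _; apply: (leUr L).
  + by apply: Mup Mx _; apply: (leUl L).
  apply: contrapT => /not_orP [/extM [m Mm hm] /extM [k Mk hk]]; apply: Me.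
  apply: (Mup ((m ⊓ k) ⊓ (x ⊔ y))); first exact: MI (MI _ _ Mm Mk) Mxy.
  rewrite (meetUr S); apply: (leUx L).
    by apply: (le_trans L) hm; rewrite (meetC L m) -(meetA L); apply: (leIr L).
  by apply: (le_trans L) hk; rewrite -(meetA L); apply: (leIr L).
Qed.

Section PrimeFilter.
Variables (P : A -> Prop) (hP : prime_filter P).

Lemma pf1 : P top. Proof. by case: hP. Qed.
Lemma pf0 : ~ P bot. Proof. by case: hP. Qed.
Lemma pfI x y : P (x ⊓ y) <-> P x /\ P y. Proof. by case: hP. Qed.
Lemma pfU x y : P (x ⊔ y) <-> P x \/ P y. Proof. by case: hP. Qed.
Lemma pf_le x y : x ⊑ y -> P x -> P y. Proof. by move=> <- /pfI []. Qed.
Lemma pf_mp x y : P (x ⇒ y) -> P x -> P y.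
Proof.
by move=> h hx; have : P (x ⊓ (x ⇒ y)); [apply/pfI|rewrite (sh_mp S) => /pfI []].
Qed.
Lemma pf_imp x y : P y -> P (x ⇒ y).
Proof. by apply: pf_le; apply/le_imp; apply: (leIl L). Qed.

Lemma pf_pc_neg x : P (pc x′) <-> ~ P x′.
Proof.
split=> [h1 h2|h].
  by apply: pf0; rewrite -(meet_pc x′); apply/pfI.
by have := pf1; rewrite -(neg_compl x) => /pfU [].
Qed.

(** Modulo a prime filter containing some [d′] and [d′′], all elements are
    complemented. *)
Lemma pf_imp_bool d x y : P d′ -> P d′′ -> P (x ⇒ y) <-> (P x -> P y).
Proof.
move=> h1 h2; split=> [|h]; first exact: pf_mp.
have [hy|hy] := pselect (P y); first exact: pf_imp.
have nx : ~ P x by move=> /h.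
have : P (d′ ⊓ d′′ ⊓ pc x′′).
  apply/pfI; split; first by apply/pfI.
  by apply/pf_pc_neg => /(pf_le (neg2_le x)).
apply: pf_le; apply: (@le_trans _ L (pc x)); last first.
  apply/le_imp; rewrite (meetC L) meet_pc; exact: (le0x L).
apply/le_imp; rewrite -(meet_pc x′′); apply: (lexI L); last first.
  by apply: (leIx2 L); apply: (leIr L).
apply: (le_trans L _ (meet_neg_neg2_le x d)).
rewrite -(meetA L x) (meetC L x); apply: (lexI L); last exact: (leIr L).
by do 2!apply: (leIx2 L); apply: (lexx L).
Qed.

Lemma pf_neg2 d x : P d′ -> P d′′ -> P x -> P x′′.
Proof.
move=> h1 h2 hx; apply: (pf_le (meet_neg_neg2_le x d)).
by apply/pfI; split=> //; apply/pfI.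
Qed.

(** [′] exchanges meets and joins, so the elements that it sends outside [P]
    form a prime filter. *)
Lemma pf_conj : prime_filter (fun x => ~ P x′).
Proof.
split=> [|h|x y|x y].
- by rewrite (neg1 HA); apply: pf0.
- by apply: h; rewrite (neg0 HA); apply: pf1.
- by rewrite (negI HA); split=> [h|[h1 h2] /pfU [] //]; split=> h'; apply/h/pfU;
    [left|right].
- rewrite negU; split=> [h|h /pfI [h1 h2]]; last by case: h.
  by apply: contrapT => /not_orP [/contrapT h1 /contrapT h2]; apply/h/pfI.
Qed.

End PrimeFilter.

(** ** Homomorphisms to the four-element algebra *)

Lemma prime_hom_D2 P d : prime_filter P -> P d′ -> P d′′ ->
  is_hom (fun x => (`[< P x >], `[< ~ P x′ >]) : D2).
Proof.
move=> hP h1 h2; have hQ := pf_conj hP.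
(* the conjugate filter contains (pc d′)′ and (pc d′)′′ *)
have k1 : ~ P (pc d′)′′′ by rewrite neg3 neg_pc_neg => /(pf_pc_neg hP).
have k2 : ~ P (pc d′)′′ by rewrite pc_neg_regular => /(pf_pc_neg hP).
pose eqb := asbool_equiv_eq; pose Q x := ~ P x′.
split=> [|x y|x|]; rewrite -/(Q _).
- split=> x y; rewrite -/(Q _).
  + by rewrite (eqb _ _ (pfU hP x y)) (eqb (Q _) _ (pfU hQ x y)) !asbool_or.
  + by rewrite (eqb _ _ (pfI hP x y)) (eqb (Q _) _ (pfI hQ x y)) !asbool_and.
- rewrite (eqb _ _ (pf_imp_bool hP x y h1 h2)).
  rewrite (eqb (Q _) _ (pf_imp_bool hQ x y k2 k1)).
  by rewrite !asbool_imply !implybE.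
- have e2 : P x′′ <-> P x by split; [apply: pf_le (neg2_le x)|apply: pf_neg2 h1 h2].
  by rewrite /Q /= -!asbool_neg notK (eqb _ _ (not_iff_compat e2)).
- split; congr pair.
  + exact: asboolF (pf0 hP).
  + exact: asboolF (pf0 hQ).
  + exact: asboolT (pf1 hP).
  + exact: asboolT (pf1 hQ).
Qed.

(** ** Homomorphisms to chains *)

Section ChainQuotient.
Variables (n : nat) (hn : 2 <= n) (Achain : valid A (chain_form n)).
Variables (F : A -> Prop) (hF : prime_filter F).
Hypothesis F_neg : forall x, F x′ <-> ~ F x.

(** [A] preordered by the filter [F]. *)
Definition fle x y : Prop := F (x ⇒ y).

Lemma le_fle x y : x ⊑ y -> fle x y.
Proof. by move/le_imp1 => h; rewrite /fle h; apply: (pf1 hF). Qed.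
Lemma fle_total x y : fle x y \/ fle y x.
Proof. by apply/(pfU hF); rewrite prelinear; apply: (pf1 hF). Qed.
Lemma fle_mp x y : fle x y -> F x -> F y. Proof. exact: pf_mp. Qed.
Lemma fle_trans y x z : fle x y -> fle y z -> fle x z.
Proof.
move=> hxy hyz; have : F ((x ⇒ y) ⊓ (y ⇒ z)) by apply/(pfI hF).
apply: (pf_le hF); apply/le_imp.
apply: (@le_trans _ L ((y ⇒ z) ⊓ y)); last exact: imp_mp.
rewrite (meetC L (x ⇒ y)) -(meetA L); apply: (lexI L); first exact: (leIl L).
by apply: (leIx2r L); apply: imp_mp.
Qed.

(** [depth m x]: there is a chain of length [m] strictly below [x]. *)
Fixpoint depth m x : Prop :=
  if m is m'.+1 then exists2 y, ~ fle x y & depth m' y else True.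

Lemma depth_mono m x y : fle x y -> depth m x -> depth m y.
Proof.
case: m => //= m hxy [z hz dz]; exists z => // hyz.
by apply: hz; apply: fle_trans hyz.
Qed.

Lemma depth_le m k x : m <= k -> depth k x -> depth m x.
Proof.
move=> hmk; rewrite -(subnK hmk); elim: (k - m) => // i IH.
case=> y hxy dy; apply: IH; apply: depth_mono dy.
by case: (fle_total x y).
Qed.

Lemma depth_seq m x : depth m x ->
  exists2 f, f 0 = x & forall i, i < m -> ~ fle (f i) (f i.+1).
Proof.
elim: m x => [|m IH] x /=; first by exists (fun=> x).
case=> y hxy /IH [f f0 hf]; exists (fun i => if i is j.+1 then f j else x) => //.
by case=> [_|i /hf //]; rewrite f0.
Qed.

(** A chain of [n - 1] elements below some [x ∉ F] would refute the chain
    formula. *)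
Lemma depth_bound x : ~ F x -> ~ depth n.-1 x.
Proof.
move=> nFx /depth_seq [f f0 hf].
have nFf i : i < n -> ~ F (f i).
  elim: i => [_|i IH hi Fi]; first by rewrite f0.
  apply: (hf i); [by lia|exact: (pf_imp hF)].
have := pf1 hF; rewrite -(Achain f).
case/(chain_form_prime (ltnW hn) (fun x y => (pfU hF x y).1)) => [[i hi]|[i hi]].
  exact: nFf.
by apply: hf; lia.
Qed.

(** The values of the homomorphism to [Cdp n]: the top on [F], and elsewhere
    the length of the longest chain strictly below [x]. *)
Lemma rank_exists x : exists m : 'I_n.-1.+1,
  (F x -> m = n.-1 :> nat) /\
  (~ F x -> [/\ m < n.-1, depth m x & ~ depth m.+1 x]).
Proof.
have [Fx|nFx] := pselect (F x); first by exists ord_max.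
suff [m [hm d1 d2]] : exists m, [/\ m < n.-1, depth m x & ~ depth m.+1 x].
  by exists (inord m); split=> // _; rewrite inordK // ltnS ltnW.
apply: contrapT => hex; apply: (depth_bound nFx).
have : forall k, k <= n.-1 -> depth k x.
  elim=> // k IH hk; apply: contrapT => nd; apply: hex; exists k.
  by split=> //; apply: IH; apply: ltnW.
exact.
Qed.

Lemma chain_hom : exists2 h : A -> Cdp n, is_hom h &
  forall x y, h x = h y -> F (x ⇒ y) /\ F (y ⇒ x).
Proof.
have /choice [h hP] := rank_exists.
have h_top x : F x -> val (h x) = n.-1 by apply: (hP x).1.
have h_depth x : ~ F x -> [/\ h x < n.-1, depth (h x) x & ~ depth (h x).+1 x].
  by apply: (hP x).2.
have h_le x y : fle x y -> h x <= h y.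
  move=> hxy; have [Fy|nFy] := pselect (F y); first by rewrite (h_top y) // -ltnS.
  have nFx : ~ F x by move/(fle_mp hxy).
  have [_ dx _] := h_depth x nFx; have [_ _ dy] := h_depth y nFy.
  rewrite leqNgt; apply/negP => lt; apply: dy; apply: (depth_le lt).
  exact: depth_mono dx.
have h_lt x y : ~ fle y x -> h x < h y.
  move=> hyx; have nFx : ~ F x by move=> Fx; apply/hyx/(pf_imp hF).
  have [ltx dx _] := h_depth x nFx.
  have [Fy|nFy] := pselect (F y); first by rewrite (h_top y).
  have [_ _ dy] := h_depth y nFy.
  rewrite ltnNge; apply/negP => le; apply: dy; apply: (@depth_le _ (h x).+1) => //.
  by exists x.
have h_leP x y : h x <= h y <-> fle x y.
  split=> [le|]; last exact: h_le.
  by apply: contrapT => /h_lt; rewrite ltnNge le.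
have h_eq x y : fle x y -> fle y x -> h x = h y.
  by move=> /h_le h1 /h_le h2; apply/val_inj/eqP; rewrite eqn_leq h1.
have F1 x : F x -> h x = ord_max by move=> /h_top e; apply: val_inj.
have h0 : h bot = ord0.
  have [_ d0 _] := h_depth bot (pf0 hF).
  apply: val_inj => /=; case: (val (h bot)) d0 => // m [y []].
  exact/le_fle/(le0x L).
have h_pc x : ~ F x -> F (pc x) -> h x = ord0.
  by move=> nFx Fpc; rewrite -h0; apply: h_eq => //; apply/le_fle/(le0x L).
exists h => [|x y e]; last by split; apply/h_leP; rewrite e.
split=> [|x y|x|]; last by split=> //; apply/F1/(pf1 hF).
- split=> x y /=; case: ifP => [/h_leP le|/negbT]; rewrite -?ltnNge.
  + apply: h_eq; last exact/le_fle/(leUr L).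
    apply: (pf_le hF) le; apply/le_imp; rewrite (meetUr S); apply: (leUx L).
      exact: imp_mp.
    exact: (leIr L).
  + move=> /ltnW /h_leP le; apply: h_eq; last exact/le_fle/(leUl L).
    apply: (pf_le hF) le; apply/le_imp; rewrite (meetUr S); apply: (leUx L).
      exact: (leIr L).
    exact: imp_mp.
  + apply: h_eq; first exact/le_fle/(leIl L).
    apply: (pf_le hF) le; apply/le_imp; apply: (lexI L); first exact: (leIr L).
    exact: imp_mp.
  + move=> /ltnW /h_leP le; apply: h_eq; first exact/le_fle/(leIr L).
    apply: (pf_le hF) le; apply/le_imp; apply: (lexI L); last exact: (leIr L).
    exact: imp_mp.
- rewrite /=; case: ifP => [/h_leP /F1 //|/negbT nle].
  have {}nle : ~ fle x y by move/h_leP; apply/negP.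
  apply: h_eq; last by apply/le_fle/le_imp/(leIl L).
  (* modulo [F], [x ⇒ y] lies below [x], or else contraction gives x ≤ y *)
  case: (fle_total x (x ⇒ y)) => [le|].
    case: nle; apply: (pf_le hF) le; apply/le_imp.
    apply: (@le_trans _ L ((x ⇒ y) ⊓ x)); last exact: imp_mp.
    apply: (lexI L); last exact: (leIr L).
    exact: imp_mp.
  apply: (pf_le hF); apply/le_imp.
  apply: (@le_trans _ L ((x ⇒ y) ⊓ x)); last exact: imp_mp.
  apply: (lexI L); first exact: (leIr L).
  exact: imp_mp.
- rewrite /=; case: eqP => [hx|hx].
    have Fx : F x.
      apply: contrapT => /h_depth [+ _ _]; rewrite hx /=; by rewrite ltnn.
    have nFx' : ~ F x′ by move/F_neg.
    by apply: h_pc => //; apply/(pf_pc_neg hF).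
  by apply: (F1); apply/F_neg => /F1.
Qed.

End ChainQuotient.

Lemma pf_neg2_filter P : prime_filter P -> prime_filter (fun x => P x′′).
Proof.
move=> hP; split=> [|h|x y|x y].
- by rewrite (neg1 HA) (neg0 HA); apply: (pf1 hP).
- by apply: (pf0 hP); rewrite -(neg1 HA) -(neg0 HA).
- by rewrite neg2I; apply: (pfI hP).
- by rewrite negD2; apply: (pfU hP).
Qed.

(** The kernels of the homomorphisms to [Cdp n] and [D2] intersect trivially:
    if [c <> 1], take a prime filter avoiding [c′′ ⊓ c′^*]. *)
Lemma separation n a b : 2 <= n -> valid A (chain_form n) -> a <> b ->
  (exists2 h : A -> D2, is_hom h & h a <> h b) \/
  (exists2 h : A -> Cdp n, is_hom h & h a <> h b).
Proof.
move=> hn Achain ab; pose c := (a ⇒ b) ⊓ (b ⇒ a).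
have c1 : c <> top.
  move=> hc; apply: ab; apply: (le_anti L); rewrite -[X in X ⊑ _](meet1x L);
    apply/le_imp; rewrite -hc; [exact: (leIl L)|exact: (leIr L)].
have [|P hP nPe] := @prime_filter_avoiding (c′′ ⊓ pc c′).
  move=> he; apply: c1; apply: (le1x L); rewrite -he.
  by apply: (leIx2 L); apply: neg2_le.
have Pcneg : P c′′ -> P c′.
  move=> h; apply: contrapT => h2; apply: nPe; apply/(pfI hP); split=> //.
  exact/(pf_pc_neg hP).
have [[d h1 h2]|nd] := pselect (exists2 d, P d′ & P d′′).
  left; have hom := prime_hom_D2 hP h1 h2; move: (hom) => [[_ hI] hi _ _].
  exists (fun x => (`[< P x >], `[< ~ P x′ >])) => // e.
  have S2 := DHMSH_sh D2_DHMSH.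
  have := hI (a ⇒ b) (b ⇒ a); rewrite !hi e (impxx S2) (meetxx (sh_lattice S2)).
  case=> /asboolP Pc /asboolP; apply; apply: Pcneg.
  exact: pf_neg2 h1 h2 Pc.
have hF := pf_neg2_filter hP.
have F_neg x : P x′′′ <-> ~ P x′′.
  rewrite neg3; split=> [h1 h2|h]; first by apply: nd; exists x.
  apply: contrapT => h'; apply: nd; exists (pc x′).
    by rewrite neg_pc_neg; apply/(pf_pc_neg hP).
  by rewrite pc_neg_regular; apply/(pf_pc_neg hP).
right; have [h hh hP'] := chain_hom hn Achain hF F_neg.
exists h => // /hP' [h1 h2].
have Pc : P c′′ by rewrite neg2I; apply/(pfI hP).
by apply: ((F_neg c).1 _ Pc); rewrite neg3; apply: Pcneg.
Qed.

End JIDL1Theory.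

(** * The logic of the join *)

(** The members of [JIDL1] validating the chain formula form a variety, and
    they embed into products of copies of [Cdp n] and [D2]. *)
Lemma variety_joinP n A : 2 <= n ->
  variety_join (variety_of (Cdp n)) (variety_of D2) A <->
  JIDL1 A /\ valid A (chain_form n).
Proof.
move=> hn; split.
  pose L := DHMSH_eqs ++ JIDL1_eqs ++ [:: (chain_form n, Top)].
  have LP B : models L B <-> JIDL1 B /\ valid B (chain_form n).
    rewrite !models_cat JIDL1P DHMSHP /=.
    by split=> [[h1 [h2 [h3 _]]]|[[h1 h2] h3]].
  move=> hA; apply/LP; apply: hA; first exact: models_variety.
  move=> B hB; case: hB => hB; apply: hB; try exact: models_variety.
    by move=> C ->; apply/LP; split; [apply: Cdp_JIDL1|apply: Cdp_chain_form].
  by move=> C ->; apply/LP; split; [apply: D2_JIDL1|apply: D2_chain_form].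
move=> [HJ Achain] V varV hV.
have VC : V (Cdp n) by apply: hV; left=> W _; apply.
have VD : V D2 by apply: hV; right=> W _; apply.
case: varV => _ subV prodV.
(* one factor for each homomorphism to [D2] or [Cdp n] *)
pose I := ({h : A -> D2 | is_hom h} + {h : A -> Cdp n | is_hom h})%type.
pose B (i : I) := if i is inl _ then D2 else Cdp n.
pose f (a : A) : product B := fun i =>
  match i return B i with inl h => sval h a | inr h => sval h a end.
apply: (subV _ _ f (prodV I B _)).
- by case.
- split=> [|x y|x|].
  + split=> x y; apply: functional_extensionality_dep => -[] [h /= hh];
      by case: hh => -[].
  + by apply: functional_extensionality_dep => -[] [h /= hh]; case: hh.
  + by apply: functional_extensionality_dep => -[] [h /= hh]; case: hh.
  + split; apply: functional_extensionality_dep => -[] [h /= hh];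
      by case: hh => _ _ _ [].
- move=> a b e; apply: contrapT => ab.
  have [] := separation HJ hn Achain ab => -[h hh]; apply.
    exact: (congr1 (fun g : product B => g (inl (exist _ h hh))) e).
  exact: (congr1 (fun g : product B => g (inr (exist _ h hh))) e).
Qed.

Lemma theorem_adjoin E a b : theorem E a -> theorem (adjoin E b) a.
Proof.
rewrite /theorem => h; elim: h => {a} // [a ha|a s Ea|a c _ h1 _ h2|a c _ h].
- exact: D_axiom.
- by apply: D_scheme; left.
- exact: D_SMP h1 h2.
- exact: D_SCP h.
Qed.

Theorem corollary12p12 (n : nat) (hn : 2 <= n) :
  (exists J : schemes, is_logic_of JIDL1 J) /\
  (forall J : schemes, is_logic_of JIDL1 J ->
     is_logic_of (variety_join (variety_of (Cdp n)) (variety_of D2))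
                 (adjoin J (chain_form n))).
Proof.
split.
  exists (fun a => forall A, JIDL1 A -> valid A a).
  exact: corresponds_is_logic_of (equational_corresponds JIDL1P).
move=> J [cJ _]; apply: corresponds_is_logic_of => A; rewrite variety_joinP //.
split=> [[HJ Achain]|[HA hA]].
  have [HA hA] := (cJ A).1 HJ; split=> //.
  by apply: theorem_sound => // b [Jb|-> //]; apply/hA/scheme_theorem.
split; last by apply/hA/scheme_theorem; right.
by apply/cJ; split=> // a ha; apply/hA/theorem_adjoin.
Qed.
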